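(* An algebraic lattice $L$ is well-founded if and only if the join-semilattice $K(L)$ of compact elements of $L$ is well-founded and contains no join-subsemilattice isomorphic to $\underline{\Omega}(\omega^* )$ or to $[\omega]^{<\omega}$.
   Context: A poset is well-founded if every non-empty subset has a minimal element (equivalently, under dependent choice, it contains no chain of type $\omega^*$, the order type of the negative integers). A lattice is algebraic if it is complete and every element is a supremum of compact elements; $K(L)$ is the set of compact elements of $L$ with the induced order (it is a join-semilattice with least element). A join-subsemilattice of a join-semilattice is a subset closed under binary joins, with the induced order. $\Omega(\omega^* )$ is the set of pairs $(i,j)$ with $i<j<\omega$, ordered by $(i,j)\leq (i',j')$ iff $i'\leq i$ and $j\leq j'$. $\underline{\Omega}(\omega^* )$ is obtained from $\Omega(\omega^* )$ by adding a least element; it is a join-semilattice. $[\omega]^{<\omega}$ is the set of finite subsets of $\omega$ ordered by inclusion. *)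

(* Defs.v *)
From HB Require Import structures.
From mathcomp Require Import all_boot all_order finmap.
From mathcomp Require Import boolp classical_sets functions cardinality.

Set Implicit Arguments.
Unset Strict Implicit.
Unset Printing Implicit Defensive.

Import Order.TTheory.

Local Open Scope classical_set_scope.
Local Open Scope order_scope.

Section Posets.
Context {d : Order.disp_t}.

Definition wf_poset (P : porderType d) : Prop :=
  forall A : set P, A !=set0 ->
    exists2 m, A m & forall x, A x -> ~ (x < m).

Definition order_isomorphic_to {d' : Order.disp_t} (S : porderType d')
    (P : porderType d) (A : set P) : Prop :=
  exists2 f : S -> P, set_bij setT A f & {mono f : x y / x <= y}.

Definition join_subsemilattice (J : joinSemilatticeType d) (A : set J) : Prop :=
  forall x y, A x -> A y -> A (x `|` y)%O.

Definition contains_join_subsemilattice_isomorphic_to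
    (J : joinSemilatticeType d) {d' : Order.disp_t}
    (S : joinSemilatticeType d') : Prop :=
  exists2 A : set J, join_subsemilattice A & order_isomorphic_to S A.

Definition complete_lattice (L : latticeType d) : Prop :=
  forall A : set L, supremums A !=set0 /\ infimums A !=set0.

(* [supremums A] is the set of least upper bounds of [A]: it has at most one
   element, and [supremums set0] consists of the least element, if any. This
   is the usual notion of compactness when [L] is complete; phrasing it with
   existing suprema only makes it meaningful for every lattice. *)
Definition compact_element (L : latticeType d) (x : L) : Prop :=
  forall (A : set L) (s : L), supremums A s -> x <= s ->
    exists F : set L, [/\ finite_set F, F `<=` A &
      exists2 t, supremums F t & x <= t].

Definition algebraic_lattice (L : latticeType d) : Prop :=
  complete_lattice L /\
  forall x : L, exists2 A : set L,
    (forall y, A y -> compact_element y) & supremums A x.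

End Posets.

(* K(L), as the subtype of the compact elements of [L] with the order induced
   by [L]; its joins are those of [L]. *)
Section CompactElements.
Context {d : Order.disp_t} (L : latticeType d).

Definition compacts : Type := set_type [set x : L | compact_element x].

HB.instance Definition _ := SubChoice.on compacts.
HB.instance Definition _ := [SubChoice_isSubPOrder of compacts by <: with d].

Lemma compact_elementU (x y : L) :
  compact_element x -> compact_element y -> compact_element (x `|` y)%O.
Proof.
move=> cx cy A s As; rewrite leUx => /andP[xs ys].
have [F [finF FA [t [tub tlub] xt]]] := cx A s As xs.
have [G [finG GA [u [uub ulub] yu]]] := cy A s As ys.
exists (F `|` G)%classic; split.
- by rewrite finite_setU.
- by move=> z [/FA|/GA].
- exists (t `|` u)%O; last by rewrite leU2.
  split=> [z [/tub zt|/uub zu]|b bub].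
  + by rewrite lexU2 ?zt.
  + by rewrite lexU2 ?zu ?orbT.
  + rewrite leUx tlub ?ulub// => z zFG; apply: bub; by [left|right].
Qed.

Fact compacts_join_subproof (x y : compacts) :
  (val x `|` val y)%O \in [set x : L | compact_element x].
Proof. by apply/mem_set/compact_elementU; apply/set_mem/valP. Qed.

Definition compacts_join (x y : compacts) : compacts :=
  Sub (val x `|` val y)%O (compacts_join_subproof x y).

Fact compacts_leUx (x y z : compacts) :
  (compacts_join x y <= z) = (x <= z) && (y <= z).
Proof. by rewrite -!Order.le_val SubK leUx. Qed.

HB.instance Definition _ :=
  @Order.POrder_isJoinSemilattice.Build d compacts compacts_join compacts_leUx.

End CompactElements.

Section AddLeast.
Context {d : Order.disp_t}.

(* [T] with a new least element [None] *)
Definition add_least (T : Type) : Type := option T.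

HB.instance Definition _ (T : choiceType) := Choice.on (add_least T).

Definition add_least_le (T : porderType d) (x y : add_least T) : bool :=
  match x, y with
  | None, _ => true
  | Some _, None => false
  | Some a, Some b => a <= b
  end.

Fact add_least_le_refl (T : porderType d) : reflexive (@add_least_le T).
Proof. by case=> /=. Qed.

Fact add_least_le_anti (T : porderType d) : antisymmetric (@add_least_le T).
Proof. by move=> [a|] [b|]//= /le_anti ->. Qed.

Fact add_least_le_trans (T : porderType d) : transitive (@add_least_le T).
Proof. by move=> [b|] [a|] [c|]//=; apply: le_trans. Qed.

HB.instance Definition _ (T : porderType d) :=
  @Order.Le_isPOrder.Build d (add_least T) (@add_least_le T)
    (@add_least_le_refl T) (@add_least_le_anti T) (@add_least_le_trans T).

Definition add_least_join (T : joinSemilatticeType d) (x y : add_least T) :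
    add_least T :=
  match x, y with
  | None, _ => y
  | _, None => x
  | Some a, Some b => Some (a `|` b)%O
  end.

Fact add_least_leUx (T : joinSemilatticeType d) (x y z : add_least T) :
  (add_least_join x y <= z) = (x <= z) && (y <= z).
Proof.
by case: x y z => [a|] [b|] [c|]//=; rewrite /Order.le/= ?leUx ?andbT.
Qed.

HB.instance Definition _ (T : joinSemilatticeType d) :=
  @Order.POrder_isJoinSemilattice.Build d (add_least T)
    (@add_least_join T) (@add_least_leUx T).

End AddLeast.

Fact Omega_display : Order.disp_t. Proof. exact: Order.Disp tt tt. Qed.

(* Omega(omega^* ): (i, j) <= (i', j') when i' <= i and j <= j', so that the
   join of two pairs always exists and is the pair of a min and a max *)
Definition Omega : Type := {p : nat * nat | (p.1 < p.2)%N}.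

HB.instance Definition _ := SubChoice.on Omega.

Definition Omega_le (p q : Omega) : bool :=
  ((val q).1 <= (val p).1)%N && ((val p).2 <= (val q).2)%N.

Fact Omega_le_refl : reflexive Omega_le.
Proof. by move=> p; rewrite /Omega_le !leqnn. Qed.

Fact Omega_le_anti : antisymmetric Omega_le.
Proof.
move=> [[a b] ab] [[a' b'] ab'] /andP[/andP[/= h1 h2] /andP[/= h3 h4]].
apply/val_inj; congr (_, _); apply/eqP.
- by rewrite eqn_leq h1 h3.
- by rewrite eqn_leq h2 h4.
Qed.

Fact Omega_le_trans : transitive Omega_le.
Proof.
move=> q p r /andP[h1 h2] /andP[h3 h4].
by rewrite /Omega_le (leq_trans h3 h1) (leq_trans h2 h4).
Qed.

HB.instance Definition _ :=
  @Order.Le_isPOrder.Build Omega_display Omega Omega_le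
    Omega_le_refl Omega_le_anti Omega_le_trans.

Fact Omega_join_subproof (p q : Omega) :
  (minn (val p).1 (val q).1 < maxn (val p).2 (val q).2)%N.
Proof. by rewrite leq_max !gtn_min (valP p). Qed.

Definition Omega_join (p q : Omega) : Omega :=
  exist _ (minn (val p).1 (val q).1, maxn (val p).2 (val q).2)
    (Omega_join_subproof p q).

Fact Omega_leUx (p q r : Omega) :
  (Omega_join p q <= r) = (p <= r) && (q <= r).
Proof.
by rewrite /Order.le/= /Omega_le/= leq_min geq_max andbACA.
Qed.

HB.instance Definition _ :=
  @Order.POrder_isJoinSemilattice.Build Omega_display Omega
    Omega_join Omega_leUx.

Definition Omega_bot : Type := add_least Omega.
HB.instance Definition _ := Order.JoinSemilattice.on Omega_bot.

Fact fin_subsets_display : Order.disp_t. Proof. exact: Order.Disp tt tt. Qed.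

(* the finite subsets of omega, ordered by inclusion *)
Definition fin_subsets_nat : Type := {fset nat}.

HB.instance Definition _ := Choice.on fin_subsets_nat.

Fact fin_subsets_le_refl :
  reflexive (fun A B : fin_subsets_nat => (A `<=` B)%fset).
Proof. by move=> A; exact: fsubset_refl. Qed.

Fact fin_subsets_le_anti :
  antisymmetric (fun A B : fin_subsets_nat => (A `<=` B)%fset).
Proof. by move=> A B; rewrite -eqEfsubset => /eqP. Qed.

Fact fin_subsets_le_trans :
  transitive (fun A B : fin_subsets_nat => (A `<=` B)%fset).
Proof. by move=> B A C; exact: fsubset_trans. Qed.

HB.instance Definition _ :=
  @Order.Le_isPOrder.Build fin_subsets_display fin_subsets_nat
    (fun A B => (A `<=` B)%fset)
    fin_subsets_le_refl fin_subsets_le_anti fin_subsets_le_trans.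

Fact fin_subsets_leUx (A B C : fin_subsets_nat) :
  ((A `|` B)%fset <= C :> fin_subsets_nat) = (A <= C) && (B <= C).
Proof. exact: fsubUset. Qed.

HB.instance Definition _ :=
  @Order.POrder_isJoinSemilattice.Build fin_subsets_display fin_subsets_nat
    (fun A B => (A `|` B)%fset) fin_subsets_leUx.

(* Main.v *)
(** If [f] embeds one of the two forbidden semilattices, the suprema of the
    images of the sets [{(i, j) | n <= i}], resp. of the finite subsets of
    [[n, oo)], are strictly decreasing in [n], by compactness.

    Conversely let [a] be strictly decreasing in [L], with [K(L)] well-founded.
    Taking [c] minimal among the compact elements above some [a n], if any, and
    the tail of [a] after [a n], one may assume that no compact element below
    [a 0] lies above any [a n].
    Say that [u] absorbs [a p] when [a p <= u `|` a q] for all [q]. If for some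
    [m] no compact [u <= a m] absorbs any [a p], a greedy choice gives an
    infinite sequence of compact elements none of which is below a finite join
    of others, hence a copy of the finite subsets of [nat]. Otherwise one builds
    compact elements [y k] and indices [p k] with [y k.+1 <= a (p k)], with
    [y k] absorbing [a (p k)] and below neither [a (p k)] nor the join of the
    earlier terms, and with [y k <= y i `|` y k.+1] for [i < k]. Then
    [y k <= y i `|` y j] iff [i <= k <= j], so that
    [(i, j) |-> y i `|` y j.-1] embeds [Omega]. *)

Require Import Defs.
From mathcomp Require Import all_boot all_order.
From mathcomp Require Import finmap boolp classical_sets functions cardinality.

Set Implicit Arguments.
Unset Strict Implicit.
Unset Printing Implicit Defensive.

Import Order.TTheory.

Local Open Scope classical_set_scope.
Local Open Scope order_scope.

(** * Well-foundedness and strictly descending sequences *)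

Lemma wf_poset_no_descending (d : Order.disp_t) (P : porderType d) :
  wf_poset P -> forall a : nat -> P, ~ forall n, a n.+1 < a n.
Proof.
move=> wfP a adec; have [|_ [n _ <-] amin] := wfP (range a).
  by exists (a 0); exists 0.
by apply: (amin (a n.+1)) => //; exists n.+1.
Qed.

Lemma not_wf_poset_descending (d : Order.disp_t) (P : porderType d) :
  ~ wf_poset P -> exists a : nat -> P, forall n, a n.+1 < a n.
Proof.
move=> /existsNP[A] /not_implyP[[a0 Aa0] nomin].
have next (x : {x : P | A x}) : {y : {x : P | A x} | sval y < sval x}.
  apply: cid; case: x => x Ax /=; apply: contra_notP nomin => /forallNP nlt.
  by exists x => // y Ay yx; apply: (nlt (exist _ y Ay)).
have [a [_ adec]] := dependent_choice next (exist _ a0 Aa0).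
by exists (fun n => sval (a n)).
Qed.

Lemma descending_homo (d : Order.disp_t) (P : porderType d) (a : nat -> P) :
  (forall n, a n.+1 < a n) -> {homo a : i j / (i <= j)%N >-> j <= i}.
Proof.
move=> adec; apply: homo_leq => [n|v w z|n]; [exact: lexx| |exact: ltW].
by move=> wv zw; exact: le_trans zw wv.
Qed.

(** * Criteria for containing the two forbidden semilattices *)

Lemma contains_of_join_embedding (d d' : Order.disp_t)
    (J : joinSemilatticeType d) (S : joinSemilatticeType d') (f : S -> J) :
    {mono f : x y / x <= y} ->
    (forall x y, f (x `|` y) <= f x `|` f y) ->
  contains_join_subsemilattice_isomorphic_to J S.
Proof.
move=> fmono fU; exists (range f).
  move=> _ _ [x _ <-] [y _ <-]; exists (x `|` y) => //.
  (* The reverse inequality follows from monotonicity, so half of join preservation suffices. *)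
  by apply/le_anti; rewrite fU leUx !fmono leUl leUr.
exists f => //; split => //.
by move=> x y _ _ fxy; apply/le_anti; rewrite -!fmono fxy lexx.
Qed.

(** A finite set is recovered from its join, which lies above [y k] only for its members [k]; [b]
    serves as the empty join. *)
Lemma contains_fin_subsets (d : Order.disp_t) (J : joinSemilatticeType d)
    (b : J) (y : nat -> J) :
    (forall x, b <= x) ->
    (forall k (F : seq nat), k \notin F ->
       ~~ (y k <= foldr (fun i => Order.join (y i)) b F)) ->
  contains_join_subsemilattice_isomorphic_to J fin_subsets_nat.
Proof.
move=> b_le indep; set f := foldr _ b in indep.
have fP (F : seq nat) x : reflect {in F, forall i, y i <= x} (f F <= x).
  elim: F => [|i F IHF] /=; first by rewrite b_le; apply: ReflectT.
  rewrite leUx; apply: (iffP andP) => [[yi /IHF yF] j|yF].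
    by rewrite inE => /predU1P[->//|/yF].
  split; first by apply: yF; rewrite mem_head.
  by apply/IHF => j jF; apply: yF; rewrite inE jF orbT.
have yf F k : (y k <= f F) = (k \in F).
  by apply/idP/idP; [apply: contraLR => /indep|apply/fP].
apply: (@contains_of_join_embedding _ _ _ _
  (fun F : fin_subsets_nat => f (F : {fset nat}))).
  move=> F G; apply/fP/fsubsetP => [FG k /FG|FG k /FG]; by rewrite yf.
move=> F G; apply/fP => k; rewrite -[_ `|` _]/(F `|` G)%fset in_fsetU.
by case/orP=> kF; rewrite lexU2// !yf; apply/orP; [left|right].
Qed.

(** A pair [(i, j)] stands for the nonempty half-open interval from [i] to [j], with last integer
    [j.-1]; the order of [Omega] is inclusion of intervals. The join assigned to a pair lies above
    exactly the [y k] with [k] in its interval. *)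
Lemma contains_Omega_bot (d : Order.disp_t) (J : joinSemilatticeType d)
    (b : J) (y : nat -> J) :
    (forall x, b <= x) ->
    (forall i j k, (i <= j)%N -> (y k <= y i `|` y j) = (i <= k <= j)%N) ->
  contains_join_subsemilattice_isomorphic_to J Omega_bot.
Proof.
move=> b_le yP.
pose g (p : Omega) := y (val p).1 `|` y (val p).2.-1.
have yg (p : Omega) k : (y k <= g p) = ((val p).1 <= k < (val p).2)%N.
  case: p => [[i [//|j]] /= ij]; by rewrite yP.
have ley (x : J) (p : Omega) :
    (g p <= x) = (y (val p).1 <= x) && (y (val p).2.-1 <= x) by rewrite leUx.
pose f (p : Omega_bot) := if p is Some p then g p else b.
apply: (@contains_of_join_embedding _ _ _ _ f).
  case=> [p|] [q|] //=; rewrite ?b_le //.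
    rewrite ley !yg; case: p q => [[i [//|j]] /= ij] [[k [//|l]] /= kl].
    rewrite [RHS]/Order.le/= /Omega_le/= !ltnS.
    apply/andP/andP => [[/andP[ki il] /andP[kj jl]]|[ki jl]]//.
    split; apply/andP; split=> //; first exact: leq_trans ij jl.
    exact: leq_trans ki ij.
  transitivity false => //; apply/negP => gb.
  (* If [g p] were below [b], then [y i] would lie below [y j] for some [i < j], against the
     hypothesis for the interval reduced to [j]. *)
  have : y (val p).1 <= y (val p).2.
    by apply: le_trans (b_le _); apply: le_trans gb; rewrite yg leqnn (valP p).
  rewrite -[leRHS]joinxx yP// => /andP[+ _].
  by rewrite leqNgt (valP p).
case=> [p|] [q|]; last 3 first.
- exact: leUl.
- exact: leUr.
- exact: leUl.
change (g (Omega_join p q) <= g p `|` g q); rewrite ley.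
case: p q => [[i [//|j]] /= ij] [[k [//|l]] /= kl].
apply/andP; split.
  rewrite lexU2//; apply/orP; rewrite /g /=.
  case: (leqP i k) => ik; [left|right]; exact: leUl.
have -> : (maxn j.+1 l.+1).-1 = maxn j l by rewrite maxnSS.
rewrite lexU2//; apply/orP; rewrite /g /=.
case: (leqP j l) => jl; [right|left]; exact: leUr.
Qed.

(** * Compact elements of an algebraic lattice *)

Section AlgebraicLattice.
Context {d : Order.disp_t} (L : latticeType d).
Local Notation K := (compacts L).

Lemma compact_val (k : K) : compact_element (val k).
Proof. exact: set_mem (valP k). Qed.

Lemma val_join (k l : K) : val (k `|` l) = val k `|` val l.
Proof. by []. Qed.

(** Compactness gives a finite subset of [D], which directedness bounds by one member; nonemptiness
    of [D] covers the empty subset. *)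
Lemma compact_le_directed (x : L) (D : set L) (s : L) :
    compact_element x -> D !=set0 ->
    (forall u v, D u -> D v -> exists w, [/\ D w, u <= w & v <= w]) ->
    supremums D s -> x <= s ->
  exists2 t, D t & x <= t.
Proof.
move=> cx [t0 Dt0] dirD Ds xs.
have [F [finF FD [t [_ tlub] xt]]] := cx D s Ds xs.
suff [w Dw Fw] : exists2 w, D w & ubound F w.
  by exists w => //; apply: le_trans xt _; apply: tlub.
have /finite_seqP[l Fl] := finF; rewrite {}Fl in FD *.
elim: l FD => [|z l IHl] FD; first by exists t0.
have [u|u Du lu] := IHl; first by move=> ul; apply: FD; rewrite /= inE ul orbT.
have [w [Dw zw uw]] := dirD z u (FD _ (mem_head _ _)) Du.
exists w => // v; rewrite /= inE => /predU1P[->//|/lu vu].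
exact: le_trans vu uw.
Qed.

Hypothesis hL : algebraic_lattice L.

(** The supremum of the empty set is compact, as the empty subfamily already covers it. *)
Lemma compacts_bottom : exists b : K, forall x : L, val b <= x.
Proof.
have [[b [_ blub]] _] := hL.1 set0.
have b_le x : b <= x by apply: blub.
suff cb : b \in [set x : L | compact_element x] by exists (exist _ b cb).
apply/mem_set => A s _ _; exists set0; split=> //.
by exists b => //; split=> // x _.
Qed.

(** Otherwise [c] would bound the compact elements whose supremum is [a]. *)
Lemma not_le_compact (a c : L) :
  ~~ (a <= c) -> exists2 x : K, val x <= a & ~~ (val x <= c).
Proof.
have [A cA [aub alub]] := hL.2 a => nac; apply: contrapT => nx.
move/negP: nac; apply; apply: alub => x Ax; apply: contrapT => /negP nxc.
by apply: nx; exists (exist _ x (mem_set (cA x Ax))) => //; apply: aub.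
Qed.

(** The joins of [u] with the compact elements below [a] form a directed set whose supremum is the
    join of [u] and [a]. *)
Lemma compact_le_join (x u : K) (a : L) :
    val x <= val u `|` a ->
  exists2 z : K, val z <= a & x <= u `|` z.
Proof.
have [b b_le] := compacts_bottom.
pose D : set L := [set val (u `|` z) | z in [set z : K | val z <= a]].
move=> xua; have [|||||_ [z za <-]] :=
  @compact_le_directed (val x) D (val u `|` a).
- exact: compact_val.
- by exists (val (u `|` b)), b => //=.
- move=> _ _ [z za <-] [w wa <-]; exists (val (u `|` (z `|` w))); split.
  + by exists (z `|` w) => //; rewrite /mkset val_join leUx za.
  + by rewrite Order.le_val leU2// leUl.
  + by rewrite Order.le_val leU2// leUr.
- split=> [_ [z za <-]|c cub]; first by rewrite val_join leU2.
  have zub (z : K) : val z <= a -> val u `|` val z <= c.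
    by move=> za; rewrite -val_join; apply: cub; exists z.
  rewrite leUx (le_trans _ (zub b (b_le a))) ?leUl//=; apply: contrapT.
  move/negP/not_le_compact => [z za /negP]; apply.
  exact: le_trans (leUr _ _) (zub z za).
- by [].
- by rewrite Order.le_val; exists z.
Qed.

(* [D n] is directed, so a compact element below [sup (f @` D n)] is below some
   [f x] with [D n x]. *)
Lemma not_wf_poset_of_embedding (d' : Order.disp_t) (S : porderType d')
    (f : S -> K) (D : nat -> set S) (s : nat -> S) :
    {mono f : x y / x <= y} ->
    (forall n x y, D n x -> D n y -> exists z, [/\ D n z, x <= z & y <= z]) ->
    (forall n, D n.+1 `<=` D n) ->
    (forall n, D n (s n)) ->
    (forall n x, D n.+1 x -> ~~ (s n <= x)) ->
  ~ wf_poset L.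
Proof.
move=> fmono dirD subD Ds sD /wf_poset_no_descending.
pose E n : set L := [set val (f x) | x in D n].
have [a aE] := choice (fun n => (hL.1 (E n)).1).
move=> /(_ a); apply=> n; rewrite lt_leAnge; apply/andP; split.
  apply: (aE n.+1).2 => _ [x Dx <-]; apply: (aE n).1; exists x => //.
  exact: subD.
apply/negP => ale; have [||||_ [x Dx <-]] :=
  @compact_le_directed (val (f (s n))) (E n.+1) (a n.+1) (@compact_val _).
- by exists (val (f (s n.+1))), (s n.+1).
- move=> _ _ [x Dx <-] [y Dy <-]; have [z [Dz xz yz]] := dirD _ _ _ Dx Dy.
  by exists (val (f z)); rewrite !Order.le_val !fmono; split=> //; exists z.
- exact: aE.
- by apply: le_trans ale; apply: (aE n).1; exists (s n).
- by rewrite Order.le_val fmono; apply/negP/sD.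
Qed.

(** * Forbidden semilattices from a descending sequence *)

Lemma descending_unbounded (a : nat -> L) :
    wf_poset K -> (forall n, a n.+1 < a n) ->
  exists b : nat -> L, (forall n, b n.+1 < b n) /\
    forall (c : K) n, val c <= b 0 -> ~~ (b n <= val c).
Proof.
move=> wfK adec; pose bad := [set c : K | exists n, a n <= val c].
have [/set0P/wfK[c [n anc] cmin]|/negP/negPn/eqP bad0] := EM (bad != set0).
  (* Starting at [n.+1] rather than [n] makes every compact element below the tail strictly smaller
     than [c]. *)
  exists (fun m => a (n.+1 + m)); split=> [m|c' m].
    by rewrite addnS.
  rewrite addn0 => c'a; apply/negP => ac'.
  apply: (cmin c'); first by exists (n.+1 + m)%N.
  rewrite -Order.SubPreorderTheory.lt_val.
  exact: le_lt_trans c'a (lt_le_trans (adec n) anc).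
exists a; split=> // c n _; apply/negP => anc.
by have : set0 c by rewrite -bad0; exists n.
Qed.

(** Each new element is chosen outside the join of all earlier ones with a term of [a] that bounds
    all later ones. *)
Lemma fin_subsets_of_descending (a : nat -> L) (m : nat) :
    {homo a : i j / (i <= j)%N >-> j <= i} ->
    (forall (u : K) p, val u <= a m -> exists q, ~~ (a p <= val u `|` a q)) ->
  contains_join_subsemilattice_isomorphic_to K fin_subsets_nat.
Proof.
move=> adec grow; have [b b_le] := compacts_bottom.
(* A state [(u, p)] records the join of the elements chosen so far and the index
   bounding the later ones. *)
pose inv (x : K * nat) := val x.1 <= a m /\ (m <= x.2)%N.
pose R (x x' : {x | inv x}) (y : K) :=
  [/\ val y <= a (sval x).2, ~~ (val y <= val (sval x).1 `|` a (sval x').2),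
      (sval x').1 = (sval x).1 `|` y & ((sval x).2 <= (sval x').2)%N].
have next (x : {x | inv x}) : {x' | exists y, R x x' y}.
  apply: cid; case: x => -[u p] /= [/= um mp].
  have [q anq] := grow u p um; have [y yp ynq] := not_le_compact anq.
  have uym : val (u `|` y) <= a m.
    by rewrite val_join leUx um (le_trans yp)// adec.
  have iny : inv (u `|` y, maxn p q) by split=> //; rewrite leq_max mp.
  exists (exist _ (u `|` y, maxn p q) iny), y.
  split=> //=; last exact: leq_maxl.
  by apply: contra ynq => /le_trans; apply; rewrite leU2// adec// leq_maxr.
have inb : inv (b, m) by [].
have [x [_ xR]] := dependent_choice next (exist _ (b, m) inb).
have [y yR] := choice xR.
pose u n := (sval (x n)).1; pose p n := (sval (x n)).2.
have umono : {homo u : i j / (i <= j)%N >-> i <= j}.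
  apply: homo_leq => [n|v w z|n]; [exact: lexx|exact: le_trans|].
  by rewrite /u; have [_ _ -> _] := yR n; exact: leUl.
have pmono : {homo p : i j / (i <= j)%N}.
  by apply: homo_leq => [n|v w z|n]; [|exact: leq_trans|have [] := yR n].
apply: (@contains_fin_subsets _ _ b y) => [z|k F kF].
  by rewrite -Order.le_val.
have [_ + _ _] := yR k; apply: contra.
rewrite -Order.le_val => /le_trans; apply.
(* For [i > k], [y i] lies below [a (p k.+1)]; for [i < k], it is already part of [u k]. *)
elim: F kF => [|i F IHF]; first by rewrite b_le.
rewrite inE negb_or => /andP[ki /IHF kF].
rewrite -[foldr _ _ _]/(y i `|` foldr (fun i => Order.join (y i)) b F).
rewrite val_join leUx {}kF andbT.
case: ltngtP ki => // ik _.
  rewrite lexU2//; apply/orP; right; have [yp _ _ _] := yR i.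
  by apply: le_trans yp (adec _ _ _); exact: pmono.
rewrite lexU2//; apply/orP; left; rewrite Order.le_val.
apply: le_trans (umono _ _ ik); rewrite /u; have [_ _ -> _] := yR i.
exact: leUr.
Qed.

Lemma Omega_bot_of_descending (a : nat -> L) :
    (forall n, a n.+1 < a n) ->
    (forall (c : K) n, val c <= a 0 -> ~~ (a n <= val c)) ->
    (forall m, exists (u : K) p,
       val u <= a m /\ forall q, a p <= val u `|` a q) ->
  contains_join_subsemilattice_isomorphic_to K Omega_bot.
Proof.
move=> astrict unb absorb; have [b b_le] := compacts_bottom.
have adec := descending_homo astrict.
have join_cover (w : K) (s : seq K) p :
    (forall u, u \in s -> val w <= val u `|` a p) ->
  exists2 z : K, val z <= a p & forall u, u \in s -> w <= u `|` z.
  elim: s => [|v s IHs] vs; first by exists b.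
  have [|z zp zs] := IHs; first by move=> u us; apply: vs; rewrite inE us orbT.
  have [z' zp' wz'] := compact_le_join (vs _ (mem_head _ _)).
  exists (z `|` z'); first by rewrite val_join leUx zp.
  move=> u; rewrite inE => /predU1P[->|/zs wz].
    by apply: le_trans wz' _; rewrite leU2// leUr.
  by apply: le_trans wz _; rewrite leU2// leUl.
(* The bound must stay compact and below [a 0] for [unb] to apply to it. *)
have join_bound (s : seq K) : (forall u, u \in s -> val u <= a 0) ->
    exists2 c : K, val c <= a 0 & forall u, u \in s -> u <= c.
  elim: s => [|v s IHs] vs; first by exists b.
  have [|c ca cs] := IHs; first by move=> u us; apply: vs; rewrite inE us orbT.
  exists (v `|` c); first by rewrite val_join leUx ca vs ?mem_head.
  move=> u; rewrite inE => /predU1P[->|/cs uc]; first exact: leUl.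
  exact: le_trans uc (leUr _ _).
(* A state [(s, p)] lists the elements chosen so far, latest first. The second
   clause of [inv] lets the next element satisfy [y k <= y i `|` y k.+1]. *)
pose inv (x : seq K * nat) :=
  (forall u, u \in x.1 -> val u <= a 0 /\ forall q, a x.2 <= val u `|` a q) /\
  (forall w s, x.1 = w :: s ->
    forall u, u \in s -> forall q, val w <= val u `|` a q).
pose R (x x' : {x | inv x}) (y : K) :=
  [/\ (sval x').1 = y :: (sval x).1, ((sval x).2 <= (sval x').2)%N,
      val y <= a (sval x).2 /\ ~~ (val y <= a (sval x').2),
      exists2 c, ~~ (y <= c) & forall u, u \in (sval x).1 -> u <= c &
      forall w s, (sval x).1 = w :: s -> forall u, u \in s -> w <= u `|` y].
have next (x : {x | inv x}) : {x' | exists y, R x x' y}.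
  apply: cid; case: x => -[s p] [/= sinv winv].
  have [u [p1 [up uabs]]] := absorb p.
  have [c c0 sc] := join_bound s (fun v vs => (sinv v vs).1).
  have [v vp vnc] := not_le_compact (unb c p c0).
  have [t tp tnp] : exists2 t : K, val t <= a p & ~~ (val t <= a p.+1).
    by apply: not_le_compact; have := astrict p; rewrite lt_leAnge => /andP[].
  have [z zp zs] : exists2 z : K, val z <= a p &
      forall w s', s = w :: s' -> forall u, u \in s' -> w <= u `|` z.
    case: (s) winv => [|w s'] winv; first by exists b.
    have [|z zp zs] := join_cover w s' p.
      by move=> u' us'; exact: (winv _ _ erefl _ us' p).
    by exists z => // _ _ [<- <-].
  (* Here [u] provides absorption, [z] covers the previous term, [v] escapes the bound [c] of the
     earlier terms, and [t] escapes [a p.+1]. In [p'], [p.+1] serves [t] and [p1] serves [u]. *)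
  pose y := u `|` z `|` (v `|` t); pose p' := maxn p.+1 p1.
  have yp : val y <= a p by rewrite !val_join !leUx up zp vp.
  have uy : u <= y by apply: le_trans (leUl _ _); exact: leUl.
  have zy : z <= y by apply: le_trans (leUl _ _); exact: leUr.
  have vy : v <= y by apply: le_trans (leUr _ _); exact: leUl.
  have ty : t <= y by apply: le_trans (leUr _ _); exact: leUr.
  have wy w s' : s = w :: s' -> forall u, u \in s' -> w <= u `|` y.
    by move=> /zs wz u' /wz /le_trans; apply; rewrite leU2.
  have pp' : (p <= p')%N by rewrite leq_max leqnSn.
  have yinv : inv (y :: s, p').
    (* For the second clause, [y] lies below [a p], which every earlier term absorbs. *)
    split=> [w|_ _ [<- <-] w /sinv[_ ws] q]; last exact: le_trans yp (ws q).
    rewrite inE => /predU1P[->|/sinv[w0 wabs]].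
      split=> [|q]; first exact: le_trans yp (adec _ _ _).
      apply: le_trans (adec _ _ (leq_maxr _ _)) _; apply: le_trans (uabs q) _.
      by rewrite leU2// Order.le_val.
    by split=> // q; apply: le_trans (wabs q); exact: adec.
  have ynp : ~~ (val y <= a p').
    apply: contra tnp => yp'; rewrite (le_trans _ (adec _ _ (leq_maxl _ p1)))//.
    by rewrite (le_trans _ yp')// Order.le_val.
  have ync : ~~ (y <= c).
    by apply: contra vnc => yc; rewrite Order.le_val (le_trans vy).
  exists (exist _ (y :: s, p') yinv), y; split=> //; by exists c.
have inv0 : inv ([::], 0%N) by [].
have [x [_ xR]] := dependent_choice next (exist _ ([::], 0%N) inv0).
have [y yR] := choice xR.
pose s n := (sval (x n)).1; pose p n := (sval (x n)).2.
have mem_s i k : (i < k)%N -> y i \in s k.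
  elim: k => // k IHk; rewrite ltnS /s; have [-> _ _ _ _] := yR k.
  by rewrite leq_eqVlt inE => /predU1P[->|/IHk ->]; rewrite ?eqxx ?orbT.
have pmono : {homo p : i j / (i <= j)%N}.
  by apply: homo_leq => [n|v w z|n]; [|exact: leq_trans|have [] := yR n].
have y_between i k : (i < k)%N -> y k <= y i `|` y k.+1.
  move=> /mem_s ik; have [_ _ _ _] := yR k.+1.
  by move=> /(_ _ _ _ _ ik); apply; have [-> _ _ _ _] := yR k.
apply: (@contains_Omega_bot _ _ b y) => [z|i j k ij].
  by rewrite -Order.le_val.
apply/idP/idP => [|/andP[ik kj]].
  apply: contraTT; rewrite negb_and -!ltnNge => /orP[ki|jk].
    (* When [k < i], both [y i] and [y j] lie below [a (p k.+1)], but [y k] does not. *)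
    have [_ _ [_ +] _ _] := yR k; apply: contra.
    rewrite -Order.le_val => /le_trans; apply.
    rewrite val_join leUx; apply/andP; split.
      by have [_ _ [+ _] _ _] := yR i => /le_trans; apply; apply/adec/pmono.
    have [_ _ [+ _] _ _] := yR j => /le_trans; apply; apply/adec/pmono.
    exact: leq_trans ki ij.
  (* When [j < k], both are earlier terms, hence below a [c] that [y k] escapes. *)
  have [_ _ _ [c + sc] _] := yR k; apply: contra => /le_trans; apply.
  by rewrite leUx !sc ?mem_s// (leq_ltn_trans ij).
(* Move the right end from [k] up to [j], each time replacing the last term by means of
   [y_between]. *)
rewrite -(subnKC kj); elim: (j - k)%N => [|n IHn]; first by rewrite addn0 leUr.
have [->|ikn] := eqVneq i k; first exact: leUl.
apply: le_trans IHn _; rewrite leUx leUl addnS y_between//.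
by rewrite ltn_addr// ltn_neqAle ikn.
Qed.

End AlgebraicLattice.

(** * Necessity of the three conditions, and the equivalence *)

Lemma wf_lattice_compacts (d : Order.disp_t) (L : latticeType d) :
  wf_poset L -> wf_poset (compacts L).
Proof.
move=> wfL; apply: contrapT => /not_wf_poset_descending[a adec].
apply: (wf_poset_no_descending wfL (a := fun n => val (a n))) => n.
by rewrite Order.SubPreorderTheory.lt_val.
Qed.

(** The pair [(n, n.+1)] belongs to [D n] but is below no pair with first coordinate greater than
    [n]. *)
Lemma wf_lattice_no_Omega_bot (d : Order.disp_t) (L : latticeType d) :
    algebraic_lattice L -> wf_poset L ->
  ~ contains_join_subsemilattice_isomorphic_to (compacts L) Omega_bot.
Proof.
move=> hL + [A _ [f _ fmono]].
pose s n : Omega_bot :=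
  Some (exist (fun p : nat * nat => p.1 < p.2)%N (n, n.+1) (ltnSn n)).
pose D n : set Omega_bot :=
  [set x | exists2 p : Omega, x = Some p & (n <= (val p).1)%N].
apply: (not_wf_poset_of_embedding hL fmono (D := D) (s := s)).
- move=> n _ _ [p -> np] [q -> nq]; exists (Some (Omega_join p q)); split.
  + by exists (Omega_join p q); rewrite //= leq_min np.
  + exact: (@leUl _ Omega p q).
  + exact: (@leUr _ Omega q p).
- by move=> n _ [p -> np]; exists p => //; exact: ltnW.
- by move=> n; eexists; [reflexivity|].
- move=> n _ [p -> np]; apply/negP => /andP[/= pn _].
  by rewrite ltnNge pn in np.
Qed.

(** The singleton of [n] belongs to [D n] but is included in no set of integers greater than [n]. *)
Lemma wf_lattice_no_fin_subsets (d : Order.disp_t) (L : latticeType d) :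
    algebraic_lattice L -> wf_poset L ->
  ~ contains_join_subsemilattice_isomorphic_to (compacts L) fin_subsets_nat.
Proof.
move=> hL + [A _ [f _ fmono]].
pose s n : fin_subsets_nat := [fset n]%fset.
pose D n : set fin_subsets_nat :=
  [set F | forall i, i \in (F : {fset nat}) -> (n <= i)%N].
apply: (not_wf_poset_of_embedding hL fmono (D := D) (s := s)).
- move=> n F G nF nG; exists (F `|` G); split; [|exact: leUl|exact: leUr].
  by move=> i; rewrite in_fsetU => /orP[/nF|/nG].
- by move=> n F nF i /nF /ltnW.
- by move=> n i; rewrite in_fset1 => /eqP ->.
- move=> n F nF; apply/negP => /fsubsetP/(_ n).
  by rewrite in_fset1 eqxx => /(_ isT) /nF; rewrite ltnn.
Qed.

Theorem mainTheorem1 (d : Order.disp_t) (L : latticeType d)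
    (hL : algebraic_lattice L) :
  wf_poset L <->
  [/\ wf_poset (compacts L),
      ~ contains_join_subsemilattice_isomorphic_to (compacts L) Omega_bot &
      ~ contains_join_subsemilattice_isomorphic_to (compacts L)
          fin_subsets_nat].
Proof.
split=> [wfL|[wfK noOmega nofin]].
  split; first exact: wf_lattice_compacts.
    exact: wf_lattice_no_Omega_bot.
  exact: wf_lattice_no_fin_subsets.
apply: contrapT => /not_wf_poset_descending[a0 a0dec].
have [a [adec unb]] := descending_unbounded wfK a0dec.
apply: noOmega; apply: (Omega_bot_of_descending hL adec unb) => m.
apply: contrapT => noabs; apply: nofin.
apply: (fin_subsets_of_descending hL (descending_homo adec) (m := m)) => u p um.
apply: contrapT => nq; apply: noabs; exists u, p; split=> // q.
by apply: contrapT => /negP npq; apply: nq; exists q.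
Qed.
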